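(* Let $k\ge 1$, let $\mu_i$ be a finite (positive, nonzero) Borel measure on $\mathbb{R}^{d_i}$ for $i=1,\dots,k$, and let $\nu$ be a finite (positive, nonzero) Borel measure on $\mathbb{R}^d$. Suppose that for each $i=1,\dots,k$ the set $\mathcal{Z}(\widehat{\mu_i})\cup\{0\}$ is an additive subgroup of $\mathbb{R}^{d_i}$. Let $\mu=\mu_1\times\cdots\times\mu_k$ and $\rho=\mu\times\nu$. If $\rho$ is a spectral measure on $\mathbb{R}^{d_1+\cdots+d_k+d}$, then $\nu$ is a spectral measure on $\mathbb{R}^d$.
   Context: For $\lambda\in\mathbb{R}^d$ write $e_\lambda(x)=e^{2\pi i\langle\lambda,x\rangle}$. A finite positive Borel measure $\tau$ on $\mathbb{R}^d$ is a spectral measure if there is a countable set $\Lambda\subset\mathbb{R}^d$, called a spectrum of $\tau$, such that $\{e_\lambda:\lambda\in\Lambda\}$ is an orthogonal basis of $L^2(\tau)$. The Fourier transform is $\widehat{\tau}(\xi)=\int e^{-2\pi i\langle \xi,x\rangle}\,d\tau(x)$, and $\mathcal{Z}(\widehat{\tau})=\{\xi\in\mathbb{R}^d:\widehat{\tau}(\xi)=0\}$. *)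

(* Defs.v *)
From HB Require Import structures.
From mathcomp Require Import all_boot all_order all_algebra.
From mathcomp Require Import all_classical all_reals all_analysis.
From mathcomp Require Import complex.

Set Implicit Arguments.
Unset Strict Implicit.
Unset Printing Implicit Defensive.

Import Order.TTheory GRing.Theory Num.Theory.
Import numFieldNormedType.Exports.

Local Open Scope classical_set_scope.
Local Open Scope ring_scope.
Local Open Scope complex_scope.

Definition borel_rV (R : realType) (n : nat) :=
  g_sigma_algebraType (@open 'rV[R]_n).

(* The product of mu and nu, transported from R^m * R^n to R^(m+n) by
   concatenation of coordinates. *)
Section product_rV.
Context (R : realType) (m n : nat).

Definition row_pair (z : borel_rV R m * borel_rV R n) : borel_rV R (m + n) :=
  row_mx z.1 z.2.

Lemma measurable_row_pair : measurable_fun [set: _] row_pair.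
Proof.
apply: (@measurability _ _ _ (borel_rV R (m + n)) _ _ (@open 'rV[R]_(m + n))) =>
  [|_ [U oU <-]]; first by [].
rewrite setTI.
pose I := ('rV[rat]_m * 'rV[rat]_n * nat)%type.
pose B p (q : 'rV[rat]_p) (k : nat) : set 'rV[R]_p :=
  (ball (map_mx (@ratr R) q) k.+1%:R^-1)°.
pose F (i : I) := if `[< B m i.1.1 i.2 `*` B n i.1.2 i.2 `<=` row_pair @^-1` U >]
  then B m i.1.1 i.2 `*` B n i.1.2 i.2 else set0.
have approx p (x : 'rV[R]_p) k : exists q : 'rV[rat]_p, B p q k x.
  have h i : exists q : rat, `|ratr q - x ord0 i| < k.+1%:R^-1 / 2 :> R.
    have : x ord0 i - k.+1%:R^-1 / 2 < x ord0 i + k.+1%:R^-1 / 2.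
      by rewrite ltrD2l gtrN// divr_gt0.
    move=> /rat_in_itvoo[q]; rewrite inE /= => /itvP hq; exists q.
    by rewrite ltr_distl !hq.
  pose q : 'rV[rat]_p := \row_i projT1 (cid (h i)).
  exists q; apply/nbhs_ballP; exists (k.+1%:R^-1 / 2) => /=.
    by rewrite divr_gt0.
  move=> y xy; rewrite [k.+1%:R^-1]splitr; apply: ball_triangle xy.
  split=> [|i j]; first by rewrite divr_gt0.
  rewrite !mxE (ord1 i); exact: (projT2 (cid (h j))).
have -> : row_pair @^-1` U = \bigcup_i F i.
  apply/seteqP; split=> [[x y] Uxy|z [i _]]; last first.
    by rewrite /F; case: ifPn => // /asboolP; exact.
  have /nbhs_ballP[e /= e0 eU] : nbhs (row_mx x y : 'rV[R]_(m + n)) U.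
    exact: open_nbhs_nbhs.
  have [k ke] : exists k, k.+1%:R^-1 + k.+1%:R^-1 < e.
    have e20 : 0 < e / 2 by rewrite divr_gt0.
    have [k _ hk] := near_infty_natSinv_lt (PosNum e20).
    exists k; rewrite (splitr e); have := hk k (leqnn k).
    by move=> /= h; rewrite ltrD.
  have [q1 B1] := approx m x k; have [q2 B2] := approx n y k.
  exists (q1, q2, k) => //; rewrite /F /=; case: ifPn; first by [].
  move=> /asboolPn[] -[x' y'] [/= /interior_subset B1' /interior_subset B2'].
  apply: eU; apply: (le_ball (ltW ke)).
  have b1 : ball x (k.+1%:R^-1 + k.+1%:R^-1) x'.
    by apply: ball_triangle B1'; apply: ball_sym; exact: interior_subset B1.
  have b2 : ball y (k.+1%:R^-1 + k.+1%:R^-1) y'.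
    by apply: ball_triangle B2'; apply: ball_sym; exact: interior_subset B2.
  split=> [|i j]; first by rewrite addr_gt0.
  by rewrite !mxE; case: splitP => j' _; [apply: b1.2|apply: b2.2].
apply: countable_bigcupT_measurable; first exact: countableP.
move=> i; rewrite /F; case: ifPn => // _.
by apply: measurableX; apply: sub_sigma_algebra; exact: open_interior.
Qed.

Variables (mu : {finite_measure set (borel_rV R m) -> \bar R})
          (nu : {finite_measure set (borel_rV R n) -> \bar R}).

Definition product_rV : set (borel_rV R (m + n)) -> \bar R :=
  pushforward (mu \x nu)%E row_pair.

Let product_rV0 : product_rV set0 = 0%E.
Proof. by rewrite /product_rV /pushforward preimage_set0 measure0. Qed.

Let product_rV_ge0 A : (0 <= product_rV A)%E.
Proof. exact: (measure_ge0 (mu \x nu)%E). Qed.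

Let product_rV_sigma_additive : semi_sigma_additive product_rV.
Proof.
move=> F mF tF mUF; rewrite /product_rV /pushforward preimage_bigcup.
apply: measure_semi_sigma_additive.
- by move=> i; rewrite -[X in measurable X]setTI; exact: measurable_row_pair.
- apply/trivIsetP => /= i j _ _ ij; rewrite -preimage_setI.
  by move/trivIsetP : tF => /(_ _ _ _ _ ij) ->//; rewrite preimage_set0.
- by rewrite -preimage_bigcup -[X in measurable X]setTI;
    exact: measurable_row_pair.
Qed.

HB.instance Definition _ := isMeasure.Build _ _ _ product_rV
  product_rV0 product_rV_ge0 product_rV_sigma_additive.

Let product_rV_finite : fin_num_fun product_rV.
Proof.
move=> A mA; apply: lty_fin_num_fun mA => //=.
rewrite /product_rV /pushforward preimage_setT -setXTT.
rewrite product_measure1E//.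
by rewrite lte_mul_pinfty// ?ge0_fin_numE// ltey_eq fin_num_measure.
Qed.

HB.instance Definition _ := Measure_isFinite.Build _ _ _ product_rV
  product_rV_finite.

Lemma product_rVE (A : set (borel_rV R m)) (B : set (borel_rV R n)) :
  measurable A -> measurable B ->
  product_rV [set x : 'rV[R]_(m + n) | A (lsubmx x) /\ B (rsubmx x)] =
  (mu A * nu B)%E.
Proof.
move=> mA mB; rewrite -product_measure1E// /product_rV /pushforward.
congr ((mu \x nu)%E _); apply/seteqP.
by split=> [[x y]|[x y]] /=; rewrite /row_pair row_mxKl row_mxKr.
Qed.

End product_rV.

(* d_1 + ... + d_k, by recursion so that it matches the type of bigproduct_rV *)
Fixpoint dimsum (k : nat) : ('I_k -> nat) -> nat :=
  if k is k'.+1 then fun d => (d ord0 + dimsum (fun i => d (lift ord0 i)))%N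
  else fun=> 0%N.

Lemma dimsumE (k : nat) (d : 'I_k -> nat) : dimsum d = (\sum_(i < k) d i)%N.
Proof.
by elim: k d => [|k IH] d; rewrite ?big_ord0// big_ord_recl /= IH.
Qed.

(* mu_1 x (mu_2 x (...)); the empty product is the unit mass on R^0. *)
Fixpoint bigproduct_rV (R : realType) (k : nat) : forall d : 'I_k -> nat,
    (forall i, {finite_measure set (borel_rV R (d i)) -> \bar R}) ->
    {finite_measure set (borel_rV R (dimsum d)) -> \bar R} :=
  if k is k'.+1 then fun d mu =>
    product_rV (mu ord0) (bigproduct_rV (fun i => mu (lift ord0 i)))
  else fun=> fun=> dirac ((0 : 'rV[R]_0) : borel_rV R 0).

Section complex_L2.
Context d (T : measurableType d) (R : realType).
Variable tau : {measure set T -> \bar R}.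
Implicit Types f g : T -> R[i].

Definition cintegral f : R[i] :=
  (\int[tau]_x complex.Re (f x)) +i* (\int[tau]_x complex.Im (f x)).

Definition cL2norm f : \bar R :=
  'N[tau]_2%:E[EFin \o (fun x => ComplexField.Normc.normc (f x))].

Definition cL2 : set (T -> R[i]) := [set f |
  [/\ measurable_fun [set: T] (fun x => complex.Re (f x)),
      measurable_fun [set: T] (fun x => complex.Im (f x))
    & (cL2norm f < +oo)%E]].

Definition cL2dot f g : R[i] := cintegral (fun x => f x * (g x)^*%C).

(* The family (u i), i in L, is an orthogonal basis of L^2(tau): nonzero,
   pairwise orthogonal vectors whose finite linear combinations are dense. *)
Definition orthogonal_basis (I : choiceType) (L : set I) (u : I -> T -> R[i]) :=
  [/\ forall i, L i -> cL2 (u i) /\ cL2dot (u i) (u i) != 0,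
      forall i j, L i -> L j -> i != j -> cL2dot (u i) (u j) = 0
    & forall f, cL2 f -> forall e : R, 0 < e ->
        exists (s : seq I) (c : I -> R[i]), [set` s] `<=` L /\
          (cL2norm (fun x => f x - \sum_(i <- s) c i * u i x)%R < e%:E)%E].

End complex_L2.

Section spectral.
Context (R : realType) (n : nat).
Implicit Types (xi lambda : 'rV[R]_n) (tau : {measure set (borel_rV R n) -> \bar R}).

Definition dot_rV (x y : 'rV[R]_n) : R := \sum_(i < n) x ord0 i * y ord0 i.

(* t |-> exp(i t) *)
Definition expi (t : R) : R[i] := cos t +i* sin t.

Definition expchar lambda (x : borel_rV R n) : R[i] :=
  expi (2 * pi * dot_rV lambda x).

Definition fourier tau xi : R[i] :=
  cintegral tau (fun x => expi (- (2 * pi * dot_rV xi x))).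

Definition fourier_zeros tau : set 'rV[R]_n := [set xi | fourier tau xi = 0].

Definition is_spectrum tau (Lambda : set 'rV[R]_n) :=
  countable Lambda /\ orthogonal_basis tau Lambda expchar.

Definition spectral_measure tau := exists Lambda, is_spectrum tau Lambda.

End spectral.

(* Main.v *)
(* A point (a, b) of a spectrum L of mu x nu is classified by a modulo the group
   G = Z(mu^) + {0}.  Frequencies b from different classes are orthogonal in
   L^2(nu), and inside a class distinct a are orthogonal in L^2(mu).  Fix f in
   L^2(nu) and let S(a) be the sum of |<f, e_b>|^2 over the b above a, and M(c)
   the supremum of S over the class c.  Choosing one a in every class yields an
   orthogonal family in L^2(nu), so the sum of all M(c) is at most |nu| |f|^2 by
   Bessel's inequality.  Parseval's identity for e_a0 (x) f writes |nu| |f|^2 as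
   S(a0) plus, for every other class, at most M(c); hence S(a0) = M(c0), and the
   fibres of L over any set of class representatives form a spectrum of nu.
   Several factors are removed one at a time. Only the weights |mu^|^2 and the
   numbers |<f, e_b>|^2 enter, so this is done on families of weights and no
   intermediate product measure has to be reassociated. *)
Require Import Defs.
From mathcomp Require Import all_boot all_order all_algebra.
From mathcomp Require Import all_classical all_reals all_analysis.
From mathcomp Require Import measurable_realfun complex ring lra.

Set Implicit Arguments.
Unset Strict Implicit.
Unset Printing Implicit Defensive.

Import Order.TTheory GRing.Theory Num.Theory.
Import numFieldNormedType.Exports.
Local Open Scope classical_set_scope.
Local Open Scope ring_scope.
Local Open Scope complex_scope.

(** * Weights on sets of frequencies *)

Section weights.
Context {R : realType}.

Definition pairwise_rel (W : Type) (E : W -> W -> Prop) (S : set W) :=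
  forall w w', S w -> S w' -> w <> w' -> E w w'.

(** An abstract Bessel inequality: [E] stands for orthogonality of two frequencies, [F w] for the
    squared coefficient of a fixed function at [w], and [N] for the bound. *)
Definition bessel (W : choiceType) (E : W -> W -> Prop) (F : W -> R) (N : R) :=
  (forall w, 0 <= F w) /\
  forall S, pairwise_rel E S -> (\esum_(w in S) (F w)%:E <= N%:E)%E.

(** Orthogonality of product characters: the Fourier transform of a product measure factorises, so
    it vanishes exactly when one factor does; [q] stands for the normalised $|\hat\mu|^2$. *)
Definition prod_rel (A : zmodType) (q : A -> R) (W : Type)
    (E : W -> W -> Prop) (z z' : A * W) :=
  q (z.1 - z'.1) = 0 \/ E z.2 z'.2.

Lemma esumZl_le (T : choiceType) (I : set T) (c : R) (f : T -> R) :
  0 <= c -> (forall i, 0 <= f i) ->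
  (\esum_(i in I) (c * f i)%:E <= c%:E * \esum_(i in I) (f i)%:E)%E.
Proof.
move=> c0 f0; rewrite ge_ereal_sup// => _ [X [finX XI] <-].
rewrite fsbig_finite//=.
rewrite (eq_bigr (fun i => c%:E * (f i)%:E)%E); last by move=> i _; rewrite EFinM.
rewrite -ge0_sume_distrr; last by move=> i _; rewrite lee_fin.
rewrite lee_wpmul2l ?lee_fin//.
by rewrite -fsbig_finite//; apply: ereal_sup_ubound; exists X.
Qed.

(** The reverse inequality is [esumZl_le] for the constant [c^-1] and the family [c * f]. *)
Lemma esumZl (T : choiceType) (I : set T) (c : R) (f : T -> R) :
  0 < c -> (forall i, 0 <= f i) ->
  (\esum_(i in I) (c * f i)%:E = c%:E * \esum_(i in I) (f i)%:E)%E.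
Proof.
move=> c0 f0; apply/eqP; rewrite eq_le; apply/andP; split.
  by apply: esumZl_le => //; exact: ltW.
have cf0 i : 0 <= c * f i by apply: mulr_ge0 => //; exact: ltW.
have := @esumZl_le _ I c^-1 _ _ cf0; rewrite invr_ge0 => /(_ (ltW c0)).
rewrite (eq_esum (b := fun i => (f i)%:E)) => [h|i _]; last first.
  by rewrite mulKf ?gt_eqF.
apply: le_trans (lee_wpmul2l _ h) _; first by rewrite lee_fin ltW.
by rewrite muleA -EFinM divff ?gt_eqF// mul1e.
Qed.

(** The fibres are disjoint, so the second projection is injective on the pairs [(i, j)] and
    reindexes the double sum. *)
Lemma esum_fibers (I J : choiceType) (P : set I) (Q : I -> set J)
    (a : J -> \bar R) :
  (forall j, 0 <= a j)%E ->
  (forall i i' j, P i -> P i' -> Q i j -> Q i' j -> i = i') ->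
  (\esum_(i in P) \esum_(j in Q i) a j =
   \esum_(j in [set j | exists2 i, P i & Q i j]) a j)%E.
Proof.
move=> a0 Qinj; rewrite (esum_esum (a := fun _ j => a j))//.
symmetry; apply: (@reindex_esum R _ _ (P `*`` Q) _ snd a); split.
- by move=> [i j] /= [Pi Qij]; exists i.
- move=> [i j] [i' j'] /set_mem[/= Pi Qij] /set_mem[/= Pi' Qij'] /= jj'.
  by rewrite -jj' in Qij' *; rewrite (Qinj _ _ _ Pi Pi' Qij Qij').
- by move=> j [i Pi Qij]; exists (i, j).
Qed.

(** * Cancelling one factor whose zeros form a group *)

Section subgroup_step.
Variables (A : zmodType) (q : A -> R) (W : choiceType) (E : W -> W -> Prop).
Let G := [set a | q a = 0 \/ a = 0].
Hypotheses (q0 : q 0 = 1)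
  (qB : forall xi, bessel (fun a a' => q (a - a') = 0) (fun a => q (a - xi)) 1)
  (GB : forall a b, G a -> G b -> G (a - b))
  (Eirr : forall w, ~ E w w).

Let q_ge0 a : 0 <= q a.
Proof. by have [+ _] := qB 0 => /(_ a); rewrite subr0. Qed.

Let G0 : G 0. Proof. by right. Qed.

Let GN a : G a -> G (- a).
Proof. by move=> Ga; rewrite -sub0r; apply: GB. Qed.

Let GC a b : G (a - b) -> G (b - a).
Proof. by move/GN; rewrite opprB. Qed.

Let Gtrans a b c : G (a - b) -> G (b - c) -> G (a - c).
Proof. by move=> ab /GN bc; have := GB ab bc; rewrite opprK addrA subrK. Qed.

Variable L : set (A * W).
Hypothesis Lorth : pairwise_rel (prod_rel q E) L.

Let P := fst @` L.
Let fiber a := [set w | L (a, w)].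
Let rep a := xget 0 [set a' | P a' /\ G (a' - a)].
Let C := rep @` P.
Let cl c := [set a | P a /\ G (a - c)].

Let repP a : P a -> P (rep a) /\ G (rep a - a).
Proof.
by move=> Pa; rewrite /rep; case: xgetP => [x _ []//|/(_ a)[]]; split; rewrite ?subrr.
Qed.

Let rep_eq a a' : G (a - a') -> rep a = rep a'.
Proof.
move=> aa'; rewrite /rep; congr xget; apply/seteqP; split=> b [Pb Gb];
  split=> //; [exact: Gtrans Gb aa'|exact: Gtrans Gb (GC aa')].
Qed.

Let rep_fix c : C c -> rep c = c.
Proof.
by move=> [a Pa <-]; have [_ ] := repP Pa; exact: rep_eq.
Qed.

Let subCP : C `<=` P.
Proof. by move=> _ [a Pa <-]; have [] := repP Pa. Qed.

Let C_eq c c' : C c -> C c' -> G (c - c') -> c = c'.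
Proof. by move=> /rep_fix cc /rep_fix cc' /rep_eq; rewrite cc cc'. Qed.

Let cl_self c : C c -> cl c c.
Proof. by move=> Cc; split; [exact: subCP|rewrite subrr]. Qed.

Let cl_eq c c' a : C c -> C c' -> cl c a -> cl c' a -> c = c'.
Proof.
by move=> Cc Cc' [_ ac] [_ ac']; apply: C_eq => //; apply: Gtrans ac'; exact: GC.
Qed.

Let cl_orth c : pairwise_rel (fun a a' => q (a - a') = 0) (cl c).
Proof.
move=> a a' [_ ac] [_ ac'] aa'.
have [//|/eqP] := Gtrans ac (GC ac').
by rewrite subr_eq0 => /eqP.
Qed.

Let selection s := forall c, C c -> cl c (s c).

(** Since [E] is irreflexive, two different points of [L] over the same [w] can only be separated by
    [q]; it then vanishes at the difference of their first components, which puts both in one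
    class. *)
Let selection_fiber_eq s c c' w : selection s -> C c -> C c' ->
  fiber (s c) w -> fiber (s c') w -> c = c'.
Proof.
move=> hs Cc Cc' Lw Lw'; have [_ sc] := hs _ Cc; have [_ sc'] := hs _ Cc'.
apply: C_eq => //; apply: (Gtrans (GC sc)).
apply: Gtrans sc'.
have [->|scc'] := pselect (s c = s c'); first by rewrite subrr.
have [|h|/Eirr//] := Lorth Lw Lw'; first by move=> -[].
by left.
Qed.

(** If [q] vanished at the difference of two selected points, these would lie in one class, hence
    coincide, against [q 0 = 1]. So [E] must hold. *)
Let selection_orth s : selection s ->
  pairwise_rel E [set w | exists2 c, C c & fiber (s c) w].
Proof.
move=> hs w w' [c Cc Lw] [c' Cc' Lw'] ww'.
have [|/= qcc'|//] := Lorth Lw Lw'; first by move=> -[].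
have cc' : c = c'.
  apply: C_eq => //; have [_ sc] := hs _ Cc; have [_ sc'] := hs _ Cc'.
  by apply: (Gtrans (GC sc)); apply: Gtrans sc'; left.
by move: qcc'; rewrite cc' subrr q0 => /eqP; rewrite oner_eq0.
Qed.

Section one_weight.
Variables (F : W -> R) (N : R).
Hypothesis FB : bessel E F N.

Let F_ge0 w : 0 <= F w. Proof. by have [] := FB. Qed.

Let S a := (\esum_(w in fiber a) (F w)%:E)%E.
Let M c := ereal_sup (S @` cl c).
(** The share of the fibre over [a] in the sum that Parseval's identity evaluates for $e_\xi\otimes
    f$. *)
Let h xi a := (\esum_(w in fiber a) (q (a - xi) * F w)%:E)%E.

Let S_ge0 a : (0 <= S a)%E.
Proof. by apply: esum_ge0 => w _; rewrite lee_fin. Qed.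

Let h_ge0 xi a : (0 <= h xi a)%E.
Proof. by apply: esum_ge0 => w _; rewrite lee_fin mulr_ge0. Qed.

Let S_le_M c a : cl c a -> (S a <= M c)%E.
Proof. by move=> ca; apply: ereal_sup_ubound; exists a. Qed.

Let M_ge0 c : C c -> (0 <= M c)%E.
Proof. by move=> Cc; apply: le_trans (S_le_M (cl_self Cc)). Qed.

Let selection_sum s : selection s ->
  (\esum_(c in C) S (s c) =
   \esum_(w in [set w | exists2 c, C c & fiber (s c) w]) (F w)%:E)%E.
Proof.
move=> hs; rewrite -(esum_fibers (Q := fun c => fiber (s c)))//.
by move=> c c' w Cc Cc'; exact: selection_fiber_eq.
Qed.

Let selection_le s : selection s -> (\esum_(c in C) S (s c) <= N%:E)%E.
Proof.
move=> hs; rewrite selection_sum//; have [_] := FB; apply.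
exact: selection_orth.
Qed.

(* The suprema may be replaced one class at a time by the values of a
   selection. *)
Let finite_sup_le (l1 l2 : seq A) s : selection s -> uniq (l1 ++ l2) ->
  {subset l1 ++ l2 <= C} ->
  (\sum_(c <- l1) M c + \sum_(c <- l2) S (s c) <= N%:E)%E.
Proof.
elim: l1 l2 s => [|c l1 IH] l2 s hs ul lC.
  rewrite big_nil add0e; apply: le_trans (selection_le hs).
  rewrite esum_ge//; exists [set` l2].
    by split; [exact: finite_seq|move=> x /= /lC; rewrite inE].
  by rewrite fsbig_seq.
have Cc : C c by apply: set_mem; apply: lC; rewrite mem_head.
have rest_ge0 : (0 <= \sum_(c <- l1) M c + \sum_(c <- l2) S (s c))%E.
  apply: adde_ge0; last exact: sume_ge0.
  rewrite big_seq; apply: sume_ge0 => x xl; apply: M_ge0; apply: set_mem.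
  by apply: lC; rewrite inE mem_cat xl orbT.
(* Moving [c] to the second list and redefining the selection at [c] alone bounds every value [S a]
   on the class; the supremum over [a] is taken at the end. *)
have key a : cl c a ->
    (S a + (\sum_(c <- l1) M c + \sum_(c <- l2) S (s c)) <= N%:E)%E.
  move=> ca; pose s' x := if x == c then a else s x.
  have hs' : selection s' by move=> x Cx; rewrite /s'; case: eqP => [->//|_]; exact: hs.
  have ul' : uniq (l1 ++ c :: l2) by rewrite -cat1s uniq_catCA.
  have := IH (c :: l2) s' hs' ul'; rewrite big_cons {1}/s' eqxx.
  rewrite addeCA (_ : \sum_(_ <- l2) S (s' _) = \sum_(c <- l2) S (s c))%E; last first.
    apply: eq_big_seq => x xl2; rewrite /s'; case: eqP => // xc.
    by move: ul => /=; rewrite -xc mem_cat xl2 orbT.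
  apply=> x xl; apply: lC; move: xl.
  by rewrite /= in_cons !mem_cat in_cons orbCA.
rewrite big_cons -addeA.
(* The remainder has to be finite to be subtracted before the supremum is taken. *)
have restfin : (\sum_(c <- l1) M c + \sum_(c <- l2) S (s c))%E \is a fin_num.
  rewrite ge0_fin_numE//; apply: le_lt_trans (ltry N).
  by apply: le_trans (key _ (cl_self Cc)); rewrite leeDr.
rewrite -leeBrDr//; apply: ge_ereal_sup => _ [a ca <-].
by rewrite leeBrDr// key.
Qed.

Let sup_sum_le : (\esum_(c in C) M c <= N%:E)%E.
Proof.
rewrite ge_ereal_sup// => _ [X [finX XC] <-].
rewrite fsbig_finite//=.
(* With an empty second list any selection will do; [id] selects the representatives. *)
have := @finite_sup_le (finmap.enum_fset (fset_set X)) [::] id.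
rewrite big_nil adde0 cats0; apply.
- by move=> c; exact: cl_self.
- exact: finmap.fset_uniq.
- by move=> x; rewrite in_fset_set// => /set_mem /XC; exact: mem_set.
Qed.

Let M_fin c : C c -> M c \is a fin_num.
Proof.
move=> Cc; rewrite ge0_fin_numE; last exact: M_ge0.
apply: le_lt_trans (ltry N); have := @finite_sup_le [:: c] [::] id.
rewrite big_nil adde0 big_seq1; apply=> //.
by move=> x; rewrite inE => /eqP ->; rewrite inE.
Qed.

Let h_le xi a c : C c -> cl c a -> (h xi a <= (fine (M c) * q (a - xi))%:E)%E.
Proof.
move=> Cc ca; apply: le_trans (esumZl_le _ (q_ge0 _) F_ge0) _.
rewrite mulrC EFinM fineK ?M_fin// lee_wpmul2l ?lee_fin//.
exact: S_le_M.
Qed.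

(** Distinct points of a class are orthogonal for [q], so [qB] bounds the total of the [q (a - xi)]
    by 1, while each fibre sum is at most [M c]. *)
Let class_le xi c : C c -> (\esum_(a in cl c) h xi a <= M c)%E.
Proof.
move=> Cc; apply: le_trans (le_esum (fun a => @h_le xi a c Cc)) _.
apply: le_trans (esumZl_le _ _ _) _ => //; first by rewrite fine_ge0// M_ge0.
rewrite fineK ?M_fin// -[leRHS]mule1 lee_wpmul2l ?M_ge0//.
by have [_] := qB xi; apply; exact: cl_orth.
Qed.

Let total_sum xi : (\esum_(z in L) (q (z.1 - xi) * F z.2)%:E =
  \esum_(c in C) \esum_(a in cl c) h xi a)%E.
Proof.
rewrite esum_fibers//.
rewrite (_ : [set a | _] = P); last first.
  apply/seteqP; split=> [a [c _ []]//|a Pa].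
  exists (rep a); first by exists a.
  by split=> //; apply: GC; have [] := repP Pa.
rewrite (esum_esum (a := fun a w => (q (a - xi) * F w)%:E)); last first.
  by move=> a w _ _; rewrite lee_fin mulr_ge0.
congr esum; apply/seteqP; split=> [[a w] Lw|[a w] []//].
by split=> //; exists (a, w).
Qed.

Lemma subgroup_bessel xi :
  (\esum_(z in L) (q (z.1 - xi) * F z.2)%:E <= N%:E)%E.
Proof.
rewrite total_sum; apply: le_trans sup_sum_le.
by apply: le_esum => c Cc; exact: class_le.
Qed.

Hypothesis LN : forall xi,
  (\esum_(z in L) (q (z.1 - xi) * F z.2)%:E = N%:E)%E.

(** Take [xi = a] in [LN]. The class of [c] contributes only [S a], as [q] vanishes at the other
    differences and is 1 at 0; every other class contributes at most its supremum. Comparison with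
    [sup_sum_le] leaves the claim. *)
Let M_le_S c a : C c -> cl c a -> (M c <= S a)%E.
Proof.
move=> Cc ca; have := sup_sum_le; rewrite -(LN a) total_sum.
rewrite !(esumID [set c] C); [|by move=> i _; exact: esum_ge0|exact: M_ge0].
have -> : C `&` [set c] = [set c] by apply/seteqP; split=> [x []|x ->].
rewrite !esum_set1 ?M_ge0//; last exact: esum_ge0.
have hS : \esum_(i in cl c) h a i = S a.
  rewrite (esumID [set a])//.
  have -> : cl c `&` [set a] = [set a] by apply/seteqP; split=> [x []|x ->].
  rewrite esum_set1// [X in (_ + X)%E]esum1 ?adde0.
    by apply: eq_esum => w _; rewrite subrr q0 mul1r.
  move=> b [cb ab]; apply: esum1 => w _.
  by rewrite (cl_orth cb ca)// mul0r.
rewrite hS => hM.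
(* The total of the other classes can be cancelled only because it is finite. *)
have restfin : \esum_(i in C `&` ~` [set c]) M i \is a fin_num.
  rewrite ge0_fin_numE; last by apply: esum_ge0 => i [Ci _]; exact: M_ge0.
  apply: le_lt_trans (ltry N); apply: le_trans sup_sum_le.
  rewrite [leRHS](esumID [set c]); last exact: M_ge0.
  by rewrite leeDr// esum_ge0// => i [Ci _]; exact: M_ge0.
rewrite -(leeD2rE _ _ restfin); apply: le_trans hM _.
by rewrite leeD2l// le_esum// => i [Ci _]; exact: class_le.
Qed.

(** Each class contributes at most [M c], which [M_le_S] bounds by the fibre sum at the
    representative; any [xi] would do in place of 0. *)
Lemma subgroup_parseval :
  (\esum_(w in [set w | exists2 c, C c & fiber c w]) (F w)%:E = N%:E)%E.
Proof.
have hid : selection id by move=> c; exact: cl_self.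
apply/eqP; rewrite eq_le -(selection_sum hid) (selection_le hid)/=.
rewrite -(LN 0) total_sum; apply: le_esum => c Cc.
by apply: le_trans (class_le _ Cc) _; apply: M_le_S => //; exact: cl_self.
Qed.

End one_weight.

(** [Gamma] is built from [L] and the representatives, independently of [F], so one set serves all
    indices [i] at once. *)
Lemma subgroup_step (I : Type) (F : I -> W -> R) (N : I -> R) :
  (forall i, bessel E (F i) (N i)) ->
  (forall i xi, \esum_(z in L) (q (z.1 - xi) * F i z.2)%:E = (N i)%:E)%E ->
  exists Gamma, [/\ Gamma `<=` snd @` L, pairwise_rel E Gamma &
    forall i, (\esum_(w in Gamma) (F i w)%:E = (N i)%:E)%E].
Proof.
move=> FB LN; exists [set w | exists2 c, C c & fiber c w]; split.
- by move=> w [c _ Lw]; exists (c, w).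
- by apply: (@selection_orth id) => c; exact: cl_self.
- by move=> i; apply: subgroup_parseval.
Qed.

End subgroup_step.

End weights.

(** * Weights that can be cancelled, and their products *)

Section factors.
Context {R : realType}.

(* The property of q = |mu^|^2 / mu(R^n)^2 that lets mu be cancelled from a
   spectral product: the first clause is Bessel's inequality for the product, the
   second turns a spectrum of the product into one of the remaining factor. *)
Definition spectral_factor (A : zmodType) (q : A -> R) :=
  [/\ q 0 = 1, forall a, 0 <= q a &
    forall (W : choiceType) (E : W -> W -> Prop), (forall w, ~ E w w) ->
    forall L : set (A * W), pairwise_rel (prod_rel q E) L ->
    (forall F N, bessel E F N -> forall xi,
      \esum_(z in L) (q (z.1 - xi) * F z.2)%:E <= N%:E)%E /\
    (forall (I : Type) (F : I -> W -> R) (N : I -> R),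
      (forall i, bessel E (F i) (N i)) ->
      (forall i xi, \esum_(z in L) (q (z.1 - xi) * F i z.2)%:E = (N i)%:E)%E ->
      exists Gamma, [/\ Gamma `<=` snd @` L, pairwise_rel E Gamma &
        forall i, (\esum_(w in Gamma) (F i w)%:E = (N i)%:E)%E])].

Lemma subgroup_spectral_factor (A : zmodType) (q : A -> R) : q 0 = 1 ->
  (forall xi, bessel (fun a a' => q (a - a') = 0) (fun a => q (a - xi)) 1) ->
  (forall a b, [set a | q a = 0 \/ a = 0] a -> [set a | q a = 0 \/ a = 0] b ->
    [set a | q a = 0 \/ a = 0] (a - b)) ->
  spectral_factor q.
Proof.
move=> q0 qB GB; split=> //.
  by move=> a; have [+ _] := qB 0 => /(_ a); rewrite subr0.
move=> W E Eirr L oL; split=> [F N FB xi|I F N FB LN].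
  exact: (subgroup_bessel q0 qB GB Eirr oL FB).
exact: (subgroup_step q0 qB GB Eirr oL FB LN).
Qed.

(** The empty product, base case of the induction on factors: a subset of the one-point space has
    total weight at most 1. *)
Lemma spectral_factor_cst1 : spectral_factor (fun _ : 'rV[R]_0 => 1 : R).
Proof.
apply: subgroup_spectral_factor => // [xi|a b _ _]; last first.
  by right; rewrite (thinmx0 (a - b)).
split=> // S _; rewrite -[leRHS](@esum_set1 R _ (0 : 'rV[R]_0) (fun=> 1%:E))//.
have -> : S = S `&` [set 0] by apply/seteqP; split=> [x Sx|x []//];
  split=> //; exact: thinmx0.
rewrite [leRHS](esumID S)// [[set 0] `&` S]setIC leeDl//.
by apply: esum_ge0 => i _; rewrite lee_fin.
Qed.

(** Reading [((a1, a2), w)] as [(a1, (a2, w))] lets [q1] be cancelled first, with [prod_rel q2 E] as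
    the relation on second components, and [q2] afterwards. *)
Lemma spectral_factorM m n (q1 : 'rV[R]_m -> R) (q2 : 'rV[R]_n -> R) :
  spectral_factor q1 -> spectral_factor q2 ->
  spectral_factor (fun a : 'rV[R]_(m + n) => q1 (lsubmx a) * q2 (rsubmx a)).
Proof.
move=> [q10 q1_ge0 q1P] [q20 q2_ge0 q2P]; split.
- by rewrite !linear0 q10 q20 mulr1.
- by move=> a; rewrite mulr_ge0.
move=> W E Eirr L oL.
pose phi (z : 'rV[R]_(m + n) * W) := (lsubmx z.1, (rsubmx z.1, z.2)).
have phiI : set_inj L phi.
  move=> [a w] [a' w'] _ _ [al ar ->].
  by rewrite -(hsubmxK a) -(hsubmxK a') al ar.
have E2irr (z : 'rV[R]_n * W) : ~ prod_rel q2 E z z.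
  by move=> [/eqP|/Eirr//]; rewrite subrr q20 oner_eq0.
have oL' : pairwise_rel (prod_rel q1 (prod_rel q2 E)) (phi @` L).
  move=> _ _ [z Lz <-] [z' Lz' <-] zz'.
  have [|/eqP|] := oL _ _ Lz Lz'; first by move=> zz; rewrite zz in zz'.
    rewrite !linearB mulf_eq0 => /orP[] /eqP h; first by left.
    by right; left.
  by move=> h; right; right.
have sumL F xi : (\esum_(z in L) (q1 (lsubmx (z.1 - xi)) *
      q2 (rsubmx (z.1 - xi)) * F z.2)%:E =
    \esum_(z in phi @` L) (q1 (z.1 - lsubmx xi) *
      (q2 (z.2.1 - rsubmx xi) * F z.2.2))%:E)%E.
  rewrite esum_image//; apply: eq_esum => z _ /=.
  by rewrite !linearB mulrA.
have [besselL stepL] := q1P _ _ E2irr _ oL'.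
(* The Bessel clause for [q2] supplies the Bessel hypothesis needed to cancel [q1]. *)
have FB2 F N xi : bessel E F N ->
    bessel (prod_rel q2 E) (fun z => q2 (z.1 - xi) * F z.2) N.
  move=> FB; split=> [z|S oS]; first by rewrite mulr_ge0//; have [] := FB.
  by have [+ _] := q2P _ _ Eirr _ oS; apply.
split=> [F N FB xi|I F N FB LN].
  by rewrite sumL; apply: (besselL (fun z => q2 (z.1 - rsubmx xi) * F z.2)); exact: FB2.
(* The second cancellation needs Parseval's identity at every shift of [q2]. Making the shift part
   of the index yields a single [G] for all shifts. *)
have [|i xi|G [GL oG GN]] := stepL ('rV[R]_n * I)%type
    (fun i z => q2 (z.1 - i.1) * F i.2 z.2) (fun i => N i.2).
- by move=> i; exact: FB2.
- rewrite -(LN i.2 (row_mx xi i.1)) sumL; apply: eq_esum => z _.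
  by rewrite row_mxKl row_mxKr.
have [_ step2] := q2P _ _ Eirr _ oG.
have [i xi|H [HG oH HN]] := step2 I F N FB; first exact: (GN (xi, i)).
exists H; split=> // w /HG[z Gz <-].
by have [_ [z' Lz' <-] <-] := GL z Gz; exists z'.
Qed.

End factors.

(** * Complex L^2 spaces *)

Definition sqnormc (R : rcfType) (z : R[i]) : R :=
  complex.Re z ^+ 2 + complex.Im z ^+ 2.

Lemma sqnormc_ge0 (R : rcfType) (z : R[i]) : 0 <= sqnormc z.
Proof. by rewrite addr_ge0 ?sqr_ge0. Qed.

Lemma sqnormc_eq0 (R : rcfType) (z : R[i]) : (sqnormc z == 0) = (z == 0).
Proof.
by case: z => a b; rewrite /sqnormc eq_complex/= paddr_eq0 ?sqr_ge0// !sqrf_eq0.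
Qed.

Lemma sqnormcM (R : rcfType) (z w : R[i]) :
  sqnormc (z * w) = sqnormc z * sqnormc w.
Proof. by case: z w => a b [c d]; rewrite /sqnormc/=; ring. Qed.

Section complex_integral.
Context d (T : measurableType d) (R : realType).
Variable tau : {measure set T -> \bar R}.
Implicit Types f g u : T -> R[i].

Implicit Types a b : T -> R.

Local Notation rintegrable a := (tau.-integrable [set: T] (EFin \o a)).

Lemma rintegrableZ (r : R) a :
  rintegrable a -> rintegrable (fun x => r * a x).
Proof. by move=> ia; exact: (integrableZl measurableT r ia). Qed.

Lemma rintegrableD a b :
  rintegrable a -> rintegrable b -> rintegrable (fun x => a x + b x).
Proof. by move=> ia ib; exact: (integrableD measurableT ia ib). Qed.

Lemma rintegrableB a b :
  rintegrable a -> rintegrable b -> rintegrable (fun x => a x - b x).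
Proof. by move=> ia ib; exact: (integrableB measurableT ia ib). Qed.

Lemma eq_rintegrable a b : a =1 b -> rintegrable a -> rintegrable b.
Proof. by move=> /funext ->. Qed.

Definition cmeasurable f :=
  measurable_fun [set: T] (fun x => complex.Re (f x)) /\
  measurable_fun [set: T] (fun x => complex.Im (f x)).

Definition cintegrable f :=
  tau.-integrable [set: T] (EFin \o (fun x => complex.Re (f x))) /\
  tau.-integrable [set: T] (EFin \o (fun x => complex.Im (f x))).

Lemma cintegralD f g : cintegrable f -> cintegrable g ->
  cintegral tau (fun x => f x + g x) = cintegral tau f + cintegral tau g.
Proof.
move=> [f1 f2] [g1 g2]; rewrite /cintegral /=.
apply/eqP; rewrite eq_complex/= -!RintegralD//.
by apply/andP; split; apply/eqP; apply: eq_Rintegral => x _; 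
  case: (f x) (g x) => ? ? [].
Qed.

Lemma cintegralZ (c : R[i]) f : cintegrable f ->
  cintegral tau (fun x => c * f x) = c * cintegral tau f.
Proof.
move=> [f1 f2]; case: c => a b; rewrite /cintegral.
apply/eqP; rewrite eq_complex/= -!RintegralZl//.
rewrite -RintegralB//; [|exact: rintegrableZ..].
rewrite -RintegralD//; [|exact: rintegrableZ..].
by apply/andP; split; apply/eqP; apply: eq_Rintegral => x _; case: (f x).
Qed.

Lemma cintegral_conj f : cintegrable f ->
  cintegral tau (fun x => (f x)^*%C) = (cintegral tau f)^*%C.
Proof.
move=> [f1 f2]; apply/eqP; rewrite eq_complex/=; apply/andP; split; apply/eqP.
  by apply: eq_Rintegral => x _; case: (f x).
rewrite -mulN1r -RintegralZl//.
by apply: eq_Rintegral => x _; case: (f x) => a b; rewrite /= mulN1r.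
Qed.

Lemma cintegrableZ c f : cintegrable f -> cintegrable (fun x => c * f x).
Proof.
move=> [f1 f2]; case: c => r1 r2; split.
  apply: (@eq_rintegrable (fun x => r1 * complex.Re (f x) - r2 * complex.Im (f x))).
    by move=> x; case: (f x).
  by apply: rintegrableB; exact: rintegrableZ.
apply: (@eq_rintegrable (fun x => r1 * complex.Im (f x) + r2 * complex.Re (f x))).
  by move=> x; case: (f x).
by apply: rintegrableD; exact: rintegrableZ.
Qed.

Definition sqnorm f : R := \int[tau]_x sqnormc (f x).

Lemma sqnorm_ge0 f : 0 <= sqnorm f.
Proof. by apply: Rintegral_ge0 => x _; exact: sqnormc_ge0. Qed.

Lemma measurable_sqnormc f :
  cmeasurable f -> measurable_fun [set: T] (fun x => sqnormc (f x)).
Proof. by move=> [m1 m2]; apply: measurable_funD; exact: measurable_funX. Qed.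

Lemma cL2norm_sqr f :
  (cL2norm tau f `^ 2 = \int[tau]_x (sqnormc (f x))%:E)%E.
Proof.
rewrite /cL2norm poweR_Lnorm//; apply: eq_integral => x _ /=.
rewrite powR_mulrn// /sqnormc; congr EFin; case: (f x) => r1 r2 /=.
by rewrite ger0_norm ?sqrtr_ge0// sqr_sqrtr// addr_ge0 ?sqr_ge0.
Qed.

(** The norm is finite exactly when its square is, so membership reduces to integrability of the
    squared modulus. *)
Lemma cL2P f : cL2 tau f <->
  cmeasurable f /\ rintegrable (fun x => sqnormc (f x)).
Proof.
split=> [[m1 m2 h]|[[m1 m2] h]]; split=> //.
  apply/integrableP; split.
    by apply/measurable_EFinP; exact: measurable_sqnormc.
  rewrite (eq_integral (fun x => (sqnormc (f x))%:E)); last first.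
    by move=> x _ /=; rewrite ger0_norm// sqnormc_ge0.
  by rewrite -cL2norm_sqr poweR_lty.
move/integrableP : h => [_].
rewrite (eq_integral (fun x => (sqnormc (f x))%:E)); last first.
  by move=> x _ /=; rewrite ger0_norm// sqnormc_ge0.
rewrite -cL2norm_sqr.
have := Lnorm_ge0 tau 2%:E
  (EFin \o (fun x => ComplexField.Normc.normc (f x))).
rewrite -/(cL2norm tau f); case: (cL2norm tau f) => [r| |//] _; first by rewrite !ltry.
by rewrite poweRyr.
Qed.

Lemma sqnormE f : cL2 tau f -> (cL2norm tau f `^ 2 = (sqnorm f)%:E)%E.
Proof.
move=> /cL2P[_ h]; rewrite cL2norm_sqr /sqnorm /Rintegral fineK//.
exact: integrable_fin_num.
Qed.

Lemma cL2norm_lt f (e : R) : cL2 tau f -> 0 < e ->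
  (cL2norm tau f < e%:E)%E = (sqnorm f < e ^+ 2).
Proof.
move=> hf e0; have := sqnormE hf.
have := Lnorm_ge0 tau 2%:E (EFin \o (fun x => ComplexField.Normc.normc (f x))).
rewrite -/(cL2norm tau f); case: (cL2norm tau f) => [r| |//]; last first.
  by move=> _; rewrite poweRyr.
rewrite lee_fin => r0 [<-]; rewrite lte_fin.
by rewrite powR_mulrn// ltr_pXn2r// nnegrE ltW.
Qed.

Lemma le_rintegrable a b : measurable_fun [set: T] a ->
  (forall x, `|a x| <= b x) -> rintegrable b -> rintegrable a.
Proof.
move=> ma ab; apply: le_integrable => //; first exact/measurable_EFinP.
by move=> x _ /=; rewrite lee_fin (le_trans (ab x))// ler_norm.
Qed.

Lemma cmeasurableM f g : cmeasurable f -> cmeasurable g ->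
  cmeasurable (fun x => f x * g x).
Proof.
move=> [f1 f2] [g1 g2]; split.
  have -> : (fun x => complex.Re (f x * g x)) =
      (fun x => complex.Re (f x) * complex.Re (g x)) \-
      (fun x => complex.Im (f x) * complex.Im (g x)).
    by apply/funext => x /=; case: (f x) (g x) => ? ? [].
  by apply: measurable_funB; exact: measurable_funM.
have -> : (fun x => complex.Im (f x * g x)) =
    (fun x => complex.Re (f x) * complex.Im (g x)) \+
    (fun x => complex.Im (f x) * complex.Re (g x)).
  by apply/funext => x /=; case: (f x) (g x) => ? ? [].
by apply: measurable_funD; exact: measurable_funM.
Qed.

Lemma cmeasurable_conj f : cmeasurable f -> cmeasurable (fun x => (f x)^*%C).
Proof.
move=> [f1 f2]; split.
  by rewrite (_ : (fun x => _) = fun x => complex.Re (f x))//;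
    apply/funext => x; case: (f x).
rewrite (_ : (fun x => _) = \- (fun x => complex.Im (f x))).
  exact: measurable_funN.
by apply/funext => x /=; case: (f x).
Qed.

Lemma cmeasurableB f g : cmeasurable f -> cmeasurable g ->
  cmeasurable (fun x => f x - g x).
Proof.
move=> [f1 f2] [g1 g2]; split.
  have -> : (fun x => complex.Re (f x - g x)) =
      (fun x => complex.Re (f x)) \- (fun x => complex.Re (g x)).
    by apply/funext => x /=; case: (f x) (g x) => ? ? [].
  exact: measurable_funB.
have -> : (fun x => complex.Im (f x - g x)) =
    (fun x => complex.Im (f x)) \- (fun x => complex.Im (g x)).
  by apply/funext => x /=; case: (f x) (g x) => ? ? [].
exact: measurable_funB.
Qed.

Lemma cmeasurable_cst (c : R[i]) : cmeasurable (cst c).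
Proof. by split; exact: measurable_cst. Qed.

(** Both parts of $f\bar g$ are dominated by $|f|^2+|g|^2$; the squares handed to [lra] give
    $2|ab|\le a^2+b^2$. *)
Lemma cL2M_cintegrable f g : cL2 tau f -> cL2 tau g ->
  cintegrable (fun x => f x * (g x)^*%C).
Proof.
move=> /cL2P[mf fi] /cL2P[mg gi].
have [m1 m2] := cmeasurableM mf (cmeasurable_conj mg).
split; apply: (@le_rintegrable _ (fun x => sqnormc (f x) + sqnormc (g x))) => //;
  try exact: rintegrableD.
- move=> x; case: (f x) (g x) => p q [r s]; rewrite /sqnormc/= mulrN opprK.
  have := (sqr_ge0 p, sqr_ge0 q, sqr_ge0 r, sqr_ge0 s).
  have := (sqr_ge0 (p + r), sqr_ge0 (p - r), sqr_ge0 (q + s), sqr_ge0 (q - s)).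
  by move=> [[[? ?] ?] ?] [[[? ?] ?] ?]; rewrite ler_norml; apply/andP; split; lra.
- move=> x; case: (f x) (g x) => p q [r s]; rewrite /sqnormc/= mulrN.
  have := (sqr_ge0 p, sqr_ge0 q, sqr_ge0 r, sqr_ge0 s).
  have := (sqr_ge0 (p + s), sqr_ge0 (p - s), sqr_ge0 (q + r), sqr_ge0 (q - r)).
  by move=> [[[? ?] ?] ?] [[[? ?] ?] ?]; rewrite ler_norml; apply/andP; split; lra.
Qed.

Lemma cL2B f g : cL2 tau f -> cL2 tau g -> cL2 tau (fun x => f x - g x).
Proof.
move=> /cL2P[mf fi] /cL2P[mg gi]; have mfg := cmeasurableB mf mg.
apply/cL2P; split=> //.
(* The slack in $|f-g|^2\le 2(|f|^2+|g|^2)$ is $|f+g|^2$. *)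
apply: (@le_rintegrable _ (fun x => 2 * (sqnormc (f x) + sqnormc (g x)))).
- exact: measurable_sqnormc.
- move=> x; rewrite ger0_norm ?sqnormc_ge0//.
  case: (f x) (g x) => p q [r s]; rewrite /sqnormc/=.
  by have := (sqr_ge0 (p + r), sqr_ge0 (q + s)) => -[? ?]; lra.
- by apply: rintegrableZ; exact: rintegrableD.
Qed.

Lemma cL2Z c f : cL2 tau f -> cL2 tau (fun x => c * f x).
Proof.
move=> /cL2P[mf fi]; apply/cL2P; split.
  by apply: cmeasurableM => //; exact: cmeasurable_cst.
apply: (@eq_rintegrable (fun x => sqnormc c * sqnormc (f x))).
  by move=> x; rewrite sqnormcM.
exact: rintegrableZ.
Qed.

Lemma cL2dotBl f u g c : cL2 tau f -> cL2 tau u -> cL2 tau g ->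
  cL2dot tau (fun x => f x - c * u x) g = cL2dot tau f g - c * cL2dot tau u g.
Proof.
move=> hf hu hg; rewrite /cL2dot -mulNr -cintegralZ; last exact: cL2M_cintegrable.
rewrite -cintegralD; [|exact: cL2M_cintegrable|].
  by congr cintegral; apply/funext => x; rewrite mulrBl mulNr mulrA.
by apply: cintegrableZ; exact: cL2M_cintegrable.
Qed.

Lemma cL2dotC f g : cL2 tau f -> cL2 tau g ->
  cL2dot tau g f = (cL2dot tau f g)^*%C.
Proof.
move=> hf hg; rewrite /cL2dot -cintegral_conj; last exact: cL2M_cintegrable.
by congr cintegral; apply/funext => x; rewrite rmorphM /= conjcK mulrC.
Qed.

Lemma cL2dot_self f : cL2dot tau f f = (sqnorm f)%:C%C.
Proof.
rewrite /cL2dot /cintegral /sqnorm; congr (_ +i* _).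
  by apply: eq_Rintegral => x _; case: (f x) => p q; rewrite /sqnormc/=; ring.
rewrite (_ : (fun x => _) = cst 0) ?Rintegral_cst ?mul0r//.
by apply/funext => x; case: (f x) => p q /=; ring.
Qed.

(* Completing the square around the optimal coefficient <f, u> / |u|^2. *)
Lemma sqnorm_sub f u c : cL2 tau f -> cL2 tau u -> 0 < sqnorm u ->
  sqnorm (fun x => f x - c * u x) =
  sqnorm f - sqnormc (cL2dot tau f u) / sqnorm u +
  sqnorm u * sqnormc (c - cL2dot tau f u / (sqnorm u)%:C%C).
Proof.
move=> hf hu u0; have hfu : cL2 tau (fun x => f x - c * u x).
  by apply: cL2B => //; exact: cL2Z.
(* Expand the inner product in its first argument, and in the second by conjugate symmetry; the real
   part of this identity is the claim. *)
have : (sqnorm (fun x => f x - c * u x))%:C%C =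
    ((sqnorm f)%:C%C - c * (cL2dot tau f u)^*%C)^*%C -
    c * (cL2dot tau f u - c * (sqnorm u)%:C%C)^*%C.
  rewrite -!cL2dot_self cL2dotBl// (cL2dotC hfu hf) (cL2dotC hfu hu).
  by rewrite !cL2dotBl// (cL2dotC hf hu).
case: (cL2dot tau f u) c {hfu} => p q [r s] /(congr1 (@complex.Re R)) /= ->.
rewrite /sqnormc /=; field.
by rewrite gt_eqF.
Qed.

(** * Bessel and Parseval for orthogonal families of constant norm *)

Section orthogonal_family.
Variables (I : choiceType) (u : I -> T -> R[i]) (M : R).
Hypotheses (uL2 : forall i, cL2 tau (u i)) (M0 : 0 < M)
  (uM : forall i, sqnorm (u i) = M).
Let orth (i j : I) := cL2dot tau (u i) (u j) = 0.

Lemma cL2_sum f (s : seq I) c : cL2 tau f ->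
  cL2 tau (fun x => f x - \sum_(i <- s) c i * u i x).
Proof.
move=> hf; elim: s => [|i s IH].
  rewrite (_ : (fun x => _) = f)//.
  by apply/funext => x; rewrite big_nil subr0.
rewrite (_ : (fun x => _) =
    fun x => (f x - \sum_(i <- s) c i * u i x) - c i * u i x).
  by apply: cL2B => //; exact: cL2Z.
by apply/funext => x; rewrite big_cons opprD addrCA addrC.
Qed.

Lemma sqnorm_sub_sum f (s : seq I) c : cL2 tau f -> uniq s ->
  pairwise_rel orth [set` s] ->
  sqnorm (fun x => f x - \sum_(i <- s) c i * u i x) =
  sqnorm f - (\sum_(i <- s) sqnormc (cL2dot tau f (u i))) / M +
  M * \sum_(i <- s) sqnormc (c i - cL2dot tau f (u i) / M%:C%C).
Proof.
move=> hf; elim: s => [|i s IH] /=.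
  rewrite !big_nil mul0r subr0 mulr0 addr0 => _ _.
  by congr sqnorm; apply/funext => x; rewrite big_nil subr0.
move=> /andP[iNs us] os.
have os' : pairwise_rel orth [set` s].
  by move=> j k js ks; apply: os; rewrite /= inE ?js ?ks orbT.
rewrite (_ : (fun x => _) =
    fun x => (f x - \sum_(i <- s) c i * u i x) - c i * u i x); last first.
  by apply/funext => x; rewrite big_cons opprD addrCA addrC.
(* The vectors already subtracted are orthogonal to [u i], so its coefficient is still that of
   [f]. *)
have dot_s (t : seq I) : {subset t <= s} ->
    cL2dot tau (fun x => f x - \sum_(i <- t) c i * u i x) (u i) =
    cL2dot tau f (u i).
  elim: t => [|j t IHt] ts.
    by congr cL2dot; apply/funext => x; rewrite big_nil subr0.
  rewrite (_ : (fun x => _) =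
      fun x => (f x - \sum_(i <- t) c i * u i x) - c j * u j x); last first.
    by apply/funext => x; rewrite big_cons opprD addrCA addrC.
  have js : j \in s by apply: ts; rewrite mem_head.
  rewrite cL2dotBl//; last exact: cL2_sum.
  rewrite IHt => [|k kt]; last by apply: ts; rewrite inE kt orbT.
  rewrite os ?mulr0 ?subr0//= ?inE ?eqxx ?js ?orbT//.
  by move=> ji; rewrite -ji js in iNs.
rewrite sqnorm_sub ?uM//; last exact: cL2_sum.
rewrite dot_s// IH// !big_cons; field.
by rewrite gt_eqF.
Qed.

Lemma parseval_gap f (s : seq I) : cL2 tau f -> uniq s ->
  pairwise_rel orth [set` s] ->
  sqnorm (fun x => f x - \sum_(i <- s) (cL2dot tau f (u i) / M%:C%C) * u i x) =
  sqnorm f - (\sum_(i <- s) sqnormc (cL2dot tau f (u i))) / M.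
Proof.
move=> hf us os; rewrite sqnorm_sub_sum// [X in M * X]big1 ?mulr0 ?addr0//.
by move=> i _; rewrite subrr /sqnormc /= expr0n addr0.
Qed.

(** On finite subsets the gap is a squared norm by [parseval_gap], hence nonnegative. *)
Lemma bessel_cL2 f : cL2 tau f ->
  bessel orth (fun i => sqnormc (cL2dot tau f (u i))) (M * sqnorm f).
Proof.
move=> hf; split=> [i|S oS]; first exact: sqnormc_ge0.
rewrite ge_ereal_sup// => _ [X [finX XS] <-].
rewrite fsbig_finite//= sumEFin lee_fin mulrC -ler_pdivrMr// -subr_ge0.
rewrite -parseval_gap ?sqnorm_ge0//.
by move=> i j /=; rewrite !in_fset_set// !inE => /XS Si /XS Sj; exact: oS.
Qed.

(** Bessel gives one inequality. For the other, density provides a good finite combination, and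
    replacing its coefficients by the optimal ones only lowers the error. *)
Lemma orthogonal_basis_esum (L : set I) f : orthogonal_basis tau L u ->
  cL2 tau f ->
  (\esum_(i in L) (sqnormc (cL2dot tau f (u i)))%:E = (M * sqnorm f)%:E)%E.
Proof.
move=> [_ oL density] hf.
have oL' : pairwise_rel orth L by move=> i j Li Lj /eqP; exact: oL.
apply/eqP; rewrite eq_le; apply/andP; split.
  by have [_] := bessel_cL2 hf; exact.
apply/lee_addgt0Pr => e e0.
(* With this tolerance the squared error times [M] stays below [e]. *)
have eM : 0 < Num.sqrt (e / M) by rewrite sqrtr_gt0 divr_gt0.
have [s [c [sL]]] := density f hf _ eM.
rewrite cL2norm_lt//; last exact: cL2_sum.
rewrite sqr_sqrtr; last by rewrite divr_ge0// ltW.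
(* The list from the density clause may repeat an index; its coefficient is then multiplied by the
   number of occurrences. *)
pose t := undup s; pose c' i := c i *+ count_mem i s.
rewrite (_ : (fun x => _) = (fun x => f x - \sum_(i <- t) c' i * u i x)); last first.
  apply/funext => x; congr (_ - _).
  rewrite -big_undup_iterop_count/=; apply: eq_bigr => i _.
  by rewrite /c' mulrnAl.
have tL : [set` t] `<=` L by move=> i /=; rewrite mem_undup => /sL.
rewrite sqnorm_sub_sum ?undup_uniq//; last first.
  by move=> i j /tL Li /tL Lj; exact: oL'.
move=> he; rewrite -leeBlDr// -EFinB; apply: esum_ge; exists [set` t].
  by split=> //; exact: finite_seq.
rewrite -fsbig_seq ?undup_uniq//= sumEFin lee_fin.
have : 0 <= M * \sum_(i <- t) sqnormc (c' i - cL2dot tau f (u i) / M%:C%C).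
  apply: mulr_ge0; first exact: ltW.
  by apply: sumr_ge0 => i _; exact: sqnormc_ge0.
move: he; set A := \sum_(i <- t) sqnormc (cL2dot _ _ _).
set B := M * _ => he B0.
have : (sqnorm f - A / M) * M < e.
  by rewrite -ltr_pdivlMr//; apply: le_lt_trans he; rewrite lerDl.
by rewrite mulrBl divfK ?gt_eqF// mulrC; lra.
Qed.

(** A finite partial sum within [M * e ^+ 2] of the total leaves a gap below [e ^+ 2], so the
    optimal coefficients on it approximate [f]. *)
Lemma esum_orthogonal_basis (L : set I) : pairwise_rel orth L ->
  (forall f, cL2 tau f ->
    (\esum_(i in L) (sqnormc (cL2dot tau f (u i)))%:E = (M * sqnorm f)%:E)%E) ->
  orthogonal_basis tau L u.
Proof.
move=> oL hL; split.
- move=> i _; split=> //; rewrite cL2dot_self uM.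
  by rewrite eq_complex/= eqxx andbT gt_eqF.
- by move=> i j Li Lj /eqP; exact: oL.
- move=> f hf e e0.
  have : ((M * sqnorm f - M * e ^+ 2)%:E <
      \esum_(i in L) (sqnormc (cL2dot tau f (u i)))%:E)%E.
    by rewrite hL// lte_fin ltrBlDr ltrDl mulr_gt0 ?exprn_gt0.
  move=> /ereal_sup_gt[_ [X [finX XL] <-]].
  rewrite fsbig_finite//= sumEFin lte_fin => hX.
  exists (finmap.enum_fset (fset_set X)), (fun i => cL2dot tau f (u i) / M%:C%C).
  have sL : [set` finmap.enum_fset (fset_set X)] `<=` L.
    by move=> i /=; rewrite in_fset_set// inE => /XL.
  split=> //; rewrite cL2norm_lt//; last exact: cL2_sum.
  rewrite parseval_gap//.
    rewrite ltrBlDr addrC -ltrBlDr ltr_pdivlMr// mulrC mulrBr.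
    exact: hX.
  by move=> i j /sL Li /sL Lj; exact: oL.
Qed.

End orthogonal_family.

End complex_integral.

(** * Fourier transforms of product measures *)

Lemma borel_continuous_measurable (R : realType) n (f : 'rV[R]_n -> R) :
  continuous f -> measurable_fun [set: borel_rV R n] (f : borel_rV R n -> R).
Proof.
move=> cf; apply: (measurability _ (RGenOpens.measurableE R)) => //.
move=> _ [_ [a [b ->] <-]]; rewrite setTI; apply: sub_sigma_algebra.
by apply: open_comp => // x _; exact: cf.
Qed.

Lemma borel_map_measurable (R : realType) m n (f : 'rV[R]_m -> 'rV[R]_n) :
  continuous f ->
  measurable_fun [set: borel_rV R m] (f : borel_rV R m -> borel_rV R n).
Proof.
move=> cf; apply: (@measurability _ _ _ (borel_rV R n) _ _ (@open 'rV[R]_n)) => //.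
move=> _ [U oU <-]; rewrite setTI; apply: sub_sigma_algebra.
by apply: open_comp => // x _; exact: cf.
Qed.

Lemma continuous_coordinates (R : realType) m n (f : 'rV[R]_m -> 'rV[R]_n)
    (s : 'I_n -> 'I_m) :
  (forall x j, f x ord0 j = x ord0 (s j)) -> continuous f.
Proof.
move=> fE x A /nbhs_ballP[e e0 eA]; apply/nbhs_ballP; exists e => // y [_ xy].
by apply: eA; split=> // i j; rewrite (ord1 i) !fE; exact: xy.
Qed.

Lemma lsubmx_measurable (R : realType) m n :
  measurable_fun [set: borel_rV R (m + n)]
    (@lsubmx R 1 m n : borel_rV R (m + n) -> borel_rV R m).
Proof.
apply: borel_map_measurable.
by apply: (@continuous_coordinates _ _ _ _ (lshift n)) => x j; rewrite mxE.
Qed.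

Lemma rsubmx_measurable (R : realType) m n :
  measurable_fun [set: borel_rV R (m + n)]
    (@rsubmx R 1 m n : borel_rV R (m + n) -> borel_rV R n).
Proof.
apply: borel_map_measurable.
by apply: (@continuous_coordinates _ _ _ _ (@rshift m n)) => x j; rewrite mxE.
Qed.

(** Tonelli for the absolute values gives integrability, after which Fubini splits the integral. *)
Lemma Rintegral_prod_meas d1 d2 (T1 : measurableType d1) (T2 : measurableType d2)
    (R : realType) (mu : {sigma_finite_measure set T1 -> \bar R})
    (nu : {sigma_finite_measure set T2 -> \bar R}) (a : T1 -> R) (b : T2 -> R) :
  mu.-integrable [set: _] (EFin \o a) -> nu.-integrable [set: _] (EFin \o b) ->
  (mu \x nu)%E.-integrable [set: _] (EFin \o (fun z => a z.1 * b z.2)) /\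
  (\int[(mu \x nu)%E]_z (a z.1 * b z.2) = \int[mu]_x a x * \int[nu]_y b y).
Proof.
move=> ia ib.
have ma : measurable_fun [set: _] a.
  by apply/measurable_EFinP; exact: measurable_int ia.
have mb : measurable_fun [set: _] b.
  by apply/measurable_EFinP; exact: measurable_int ib.
have iab : (mu \x nu)%E.-integrable [set: _] (EFin \o (fun z => a z.1 * b z.2)).
  apply/integrable12ltyP.
    apply/measurable_EFinP; apply: measurable_funM.
      exact: measurableT_comp.
    exact: measurableT_comp.
  have -> : (fun x => \int[nu]_y `|(a x * b y)%R%:E|)%E =
      (fun x => (\int[nu]_y `|(b y)%:E|) * `|(a x)%:E|)%E.
    apply/funext => x; rewrite muleC -ge0_integralZl//.
    - by apply: eq_integral => y _ /=; rewrite -EFinM normrM.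
    - by apply: measurableT_comp => //; exact: measurable_int ib.
  move/integrableP : ia => [_ ia]; move/integrableP : ib => [_ ib].
  rewrite ge0_integralZl//.
  - by rewrite lte_mul_pinfty ?ge0_fin_numE ?integral_ge0.
  - by apply: measurableT_comp => //; exact/measurable_EFinP.
  - exact: integral_ge0.
split=> //; rewrite /Rintegral -integral12_prod_meas1// /fubini_F/=.
have -> : (fun x => \int[nu]_y (a x * b y)%R%:E)%E =
    (fun x => (\int[nu]_y (b y)%:E) * (a x)%:E)%E.
  apply/funext => x; rewrite muleC -integralZl//.
rewrite -(fineK (integrable_fin_num measurableT ib)) integralZl// fineM//.
  by rewrite mulrC.
exact: integrable_fin_num.
Qed.

Section product_integral.
Context (R : realType) (m n : nat).
Variables (mu : {finite_measure set (borel_rV R m) -> \bar R})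
          (nu : {finite_measure set (borel_rV R n) -> \bar R}).

Lemma Rintegral_product_rV (a : borel_rV R m -> R) (b : borel_rV R n -> R) :
  mu.-integrable [set: _] (EFin \o a) -> nu.-integrable [set: _] (EFin \o b) ->
  (product_rV mu nu).-integrable [set: _]
    (EFin \o (fun w => a (lsubmx w) * b (rsubmx w))) /\
  (\int[product_rV mu nu]_w (a (lsubmx w) * b (rsubmx w)) =
   \int[mu]_x a x * \int[nu]_y b y).
Proof.
move=> ia ib; have [iab abE] := Rintegral_prod_meas ia ib.
have mh : measurable_fun [set: borel_rV R (m + n)]
    (EFin \o (fun w : borel_rV R (m + n) => a (lsubmx w) * b (rsubmx w))).
  apply/measurable_EFinP; apply: measurable_funM.
    apply: measurableT_comp (@lsubmx_measurable R m n).
    by apply/measurable_EFinP; exact: measurable_int ia.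
  apply: measurableT_comp (@rsubmx_measurable R m n).
  by apply/measurable_EFinP; exact: measurable_int ib.
have hE : (EFin \o (fun w : borel_rV R (m + n) => a (lsubmx w) * b (rsubmx w))) \o
    (@row_pair R m n) = EFin \o (fun z => a z.1 * b z.2).
  by apply/funext => z /=; rewrite /row_pair row_mxKl row_mxKr.
split.
  apply: integrable_pushforward => //; first exact: measurable_row_pair.
  by rewrite preimage_setT hE.
rewrite -abE /Rintegral; congr fine.
rewrite (@integral_pushforward _ _ _ _ _ _ (@measurable_row_pair R m n) (mu \x nu)%E)//.
  by rewrite preimage_setT; apply: eq_integral => z _; rewrite hE.
by rewrite preimage_setT hE.
Qed.

Lemma cintegral_product_rV (f : borel_rV R m -> R[i]) (g : borel_rV R n -> R[i]) :
  cintegrable mu f -> cintegrable nu g ->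
  cintegral (product_rV mu nu) (fun w => f (lsubmx w) * g (rsubmx w)) =
  cintegral mu f * cintegral nu g.
Proof.
move=> [f1 f2] [g1 g2]; apply/eqP; rewrite eq_complex /cintegral/=.
have [i11 <-] := Rintegral_product_rV f1 g1.
have [i12 <-] := Rintegral_product_rV f1 g2.
have [i21 <-] := Rintegral_product_rV f2 g1.
have [i22 <-] := Rintegral_product_rV f2 g2.
rewrite -RintegralB// -RintegralD//.
by apply/andP; split; apply/eqP; apply: eq_Rintegral => w _;
  case: (f _) (g _) => ? ? [].
Qed.

Lemma cL2_product_rV (f : borel_rV R m -> R[i]) (g : borel_rV R n -> R[i]) :
  cL2 mu f -> cL2 nu g ->
  cL2 (product_rV mu nu) (fun w => f (lsubmx w) * g (rsubmx w)) /\
  sqnorm (product_rV mu nu) (fun w => f (lsubmx w) * g (rsubmx w)) =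
  sqnorm mu f * sqnorm nu g.
Proof.
move=> /cL2P[mf fi] /cL2P[mg gi].
have [ifg <-] := Rintegral_product_rV fi gi.
have hE : (fun w => sqnormc (f (lsubmx w) * g (rsubmx w))) =
    (fun w : borel_rV R (m + n) => sqnormc (f (lsubmx w)) * sqnormc (g (rsubmx w))).
  by apply/funext => w; rewrite sqnormcM.
split; last by rewrite /sqnorm hE.
apply/cL2P; split; last by rewrite hE.
apply: cmeasurableM.
  case: mf => f1 f2; have ml := @lsubmx_measurable R m n.
  by split; [exact: (measurableT_comp f1 ml)|exact: (measurableT_comp f2 ml)].
case: mg => g1 g2; have mr := @rsubmx_measurable R m n.
by split; [exact: (measurableT_comp g1 mr)|exact: (measurableT_comp g2 mr)].
Qed.

End product_integral.

Lemma expiD (R : realType) (s t : R) : expi (s + t) = expi s * expi t.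
Proof. by apply/eqP; rewrite eq_complex/= cosD sinD eqxx/= addrC. Qed.

Lemma expiN (R : realType) (t : R) : expi (- t) = (expi t)^*%C.
Proof. by rewrite /expi cosN sinN. Qed.

Lemma sqnormc_expi (R : realType) (t : R) : sqnormc (expi t) = 1.
Proof. exact: cos2Dsin2. Qed.

(** * Characters and Fourier coefficients *)

Section characters.
Context (R : realType).

Lemma dot_rVBl n (x y z : 'rV[R]_n) : dot_rV (x - y) z = dot_rV x z - dot_rV y z.
Proof.
by rewrite /dot_rV -sumrB; apply: eq_bigr => i _; rewrite !mxE mulrBl.
Qed.

Lemma dot_rV_row_mx m n (a : 'rV[R]_m) (b : 'rV[R]_n) w :
  dot_rV (row_mx a b) w = dot_rV a (lsubmx w) + dot_rV b (rsubmx w).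
Proof.
rewrite /dot_rV big_split_ord/=.
by congr (_ + _); apply: eq_bigr => i _; rewrite ?row_mxEl ?row_mxEr mxE.
Qed.

Lemma expchar_row_mx m n (a : 'rV[R]_m) (b : 'rV[R]_n) w :
  expchar (row_mx a b) w = expchar a (lsubmx w) * expchar b (rsubmx w).
Proof. by rewrite /expchar dot_rV_row_mx mulrDr expiD. Qed.

Lemma fourierE n (tau : {measure set (borel_rV R n) -> \bar R}) xi :
  fourier tau xi = cintegral tau (fun x => (expchar xi x)^*%C).
Proof. by congr cintegral; apply/funext => x; rewrite expiN. Qed.

(** This makes inner products of characters values of the Fourier transform at differences of
    frequencies. *)
Lemma expchar_mul_conj n (a b : 'rV[R]_n) x :
  expchar a x * (expchar b x)^*%C = (expchar (b - a) x)^*%C.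
Proof. by rewrite /expchar -!expiN -expiD dot_rVBl; congr expi; ring. Qed.

Lemma sqnormc_expchar n (a : 'rV[R]_n) x : sqnormc (expchar a x) = 1.
Proof. exact: sqnormc_expi. Qed.

Lemma measurable_dot_rV n (a : 'rV[R]_n) :
  measurable_fun [set: borel_rV R n] (dot_rV a : borel_rV R n -> R).
Proof.
apply: measurable_sum => i; apply: measurable_funM => //.
by apply: borel_continuous_measurable => x; exact: coord_continuous.
Qed.

Lemma cmeasurable_expchar n (a : 'rV[R]_n) : cmeasurable (expchar a).
Proof.
have m2 : measurable_fun [set: borel_rV R n]
    (fun x : borel_rV R n => 2 * pi * dot_rV a x).
  by apply: measurable_funM => //; exact: measurable_dot_rV.
split; apply: measurableT_comp m2; apply: continuous_measurable_fun => x.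
  exact: continuous_cos.
exact: continuous_sin.
Qed.

Section finite_measure.
Variables (n : nat) (tau : {finite_measure set (borel_rV R n) -> \bar R}).

Definition mass := fine (tau [set: _]).

Lemma sqnorm_expchar a : sqnorm tau (expchar a) = mass.
Proof.
rewrite /sqnorm (_ : (fun x => _) = cst 1) ?Rintegral_cst ?mul1r//.
by apply/funext => x; exact: sqnormc_expchar.
Qed.

Lemma cL2_expchar a : cL2 tau (expchar a).
Proof.
apply/cL2P; split; first exact: cmeasurable_expchar.
rewrite (_ : (fun x => _) = cst 1); first exact: finite_measure_integrable_cst.
by apply/funext => x; exact: sqnormc_expchar.
Qed.

Lemma cL2dot_expchar a b : cL2dot tau (expchar a) (expchar b) = fourier tau (b - a).
Proof.
rewrite fourierE; congr cintegral; apply/funext => x.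
exact: expchar_mul_conj.
Qed.

Lemma fourier0 : fourier tau 0 = mass%:C%C.
Proof. by rewrite -(subrr 0) -cL2dot_expchar cL2dot_self sqnorm_expchar. Qed.

Lemma cintegrable_expchar_conj a : cintegrable tau (fun x => (expchar a x)^*%C).
Proof.
have := cL2M_cintegrable (cL2_expchar 0) (cL2_expchar a).
congr cintegrable; apply/funext => x.
by rewrite expchar_mul_conj subr0.
Qed.

End finite_measure.

Lemma fourier_product_rV m n (mu : {finite_measure set (borel_rV R m) -> \bar R})
    (nu : {finite_measure set (borel_rV R n) -> \bar R}) a :
  fourier (product_rV mu nu) a = fourier mu (lsubmx a) * fourier nu (rsubmx a).
Proof.
rewrite !fourierE -cintegral_product_rV; [|exact: cintegrable_expchar_conj..].
congr cintegral; apply/funext => w.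
by rewrite -[in LHS](hsubmxK a) expchar_row_mx rmorphM.
Qed.

(** The source of the weighted sums: the squared coefficient of $e_\xi\otimes f$ is a shifted
    $|\hat\mu|^2$ times a squared coefficient of [f]. *)
Lemma cL2dot_product_rV m n (mu : {finite_measure set (borel_rV R m) -> \bar R})
    (nu : {finite_measure set (borel_rV R n) -> \bar R}) xi f a : cL2 nu f ->
  cL2dot (product_rV mu nu) (fun w => expchar xi (lsubmx w) * f (rsubmx w))
    (expchar a) =
  fourier mu (lsubmx a - xi) * cL2dot nu f (expchar (rsubmx a)).
Proof.
move=> hf; rewrite -cL2dot_expchar -cintegral_product_rV.
- congr cintegral; apply/funext => w.
  by rewrite -[in LHS](hsubmxK a) expchar_row_mx rmorphM mulrACA.
- by apply: cL2M_cintegrable; exact: cL2_expchar.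
- by apply: cL2M_cintegrable => //; exact: cL2_expchar.
Qed.

(** * Normalised Fourier weights of the factors and of their product *)

Section normalized_fourier.
Variable n : nat.
Implicit Type tau : {finite_measure set (borel_rV R n) -> \bar R}.

Definition fourier_weight tau (a : 'rV[R]_n) : R :=
  sqnormc (fourier tau a) / mass tau ^+ 2.

Lemma mass_gt0 tau : tau [set: _] != 0%E -> 0 < mass tau.
Proof.
move=> tau0; rewrite fine_gt0// lt0e tau0 measure_ge0/=.
by rewrite -ge0_fin_numE// fin_num_measure.
Qed.

Lemma fourier_weight0 tau : 0 < mass tau -> fourier_weight tau 0 = 1.
Proof.
move=> tau0; rewrite /fourier_weight fourier0 /sqnormc/= expr0n addr0 divff//.
by rewrite sqrf_eq0 gt_eqF.
Qed.

Lemma fourier_weight_eq0 tau a : 0 < mass tau ->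
  fourier_weight tau a = 0 <-> fourier tau a = 0.
Proof.
move=> tau0; split=> [/eqP|/eqP]; last first.
  by rewrite -sqnormc_eq0 => /eqP h; rewrite /fourier_weight h mul0r.
rewrite mulf_eq0 invr_eq0 sqrf_eq0 (gt_eqF tau0) orbF sqnormc_eq0.
by move/eqP.
Qed.

Lemma fourier_weight_factor tau : tau [set: _] != 0%E ->
  zmod_closed (mem (fourier_zeros tau `|` [set 0])) ->
  spectral_factor (fourier_weight tau).
Proof.
move=> /mass_gt0 tau0 [_ GB].
have weightG a : (a \in mem (fourier_zeros tau `|` [set 0])) <->
    fourier_weight tau a = 0 \/ a = 0.
  rewrite fourier_weight_eq0//; split; first by move/set_mem.
  by move=> h; apply/mem_set.
apply: subgroup_spectral_factor; first exact: fourier_weight0.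
- move=> xi; split=> [a|S oS].
    by rewrite divr_ge0 ?sqnormc_ge0// sqr_ge0.
  (* Bessel's inequality for the function [expchar xi], whose coefficients are the values of the
     Fourier transform at [a - xi]. *)
  have [_ /(_ S)] := bessel_cL2 (@cL2_expchar n tau) tau0 (@sqnorm_expchar n tau)
    (@cL2_expchar n tau xi).
  rewrite sqnorm_expchar => hB.
  apply: le_trans
    (_ : ((mass tau ^+ 2)^-1%:E * (mass tau ^+ 2)%:E <= 1)%E); last first.
    by rewrite -EFinM mulVf// sqrf_eq0 gt_eqF.
  rewrite /fourier_weight; under eq_esum do rewrite mulrC.
  apply: le_trans (esumZl_le _ _ _) _; rewrite ?invr_ge0 ?sqr_ge0//.
    by move=> a; exact: sqnormc_ge0.
  rewrite lee_wpmul2l ?lee_fin ?invr_ge0 ?sqr_ge0//.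
  under eq_esum do rewrite -cL2dot_expchar.
  apply: hB => a b Sa Sb ab; rewrite cL2dot_expchar.
  by apply/fourier_weight_eq0 => //; apply: oS => // ba; exact: ab.
- by move=> a b /weightG Ga /weightG Gb; apply/weightG; exact: GB.
Qed.

End normalized_fourier.

(** The mass is the Fourier transform at 0, where it factorises. *)
Lemma mass_product_rV m n (mu : {finite_measure set (borel_rV R m) -> \bar R})
    (nu : {finite_measure set (borel_rV R n) -> \bar R}) :
  mass (product_rV mu nu) = mass mu * mass nu.
Proof.
apply: complexI; rewrite rmorphM /= -!fourier0 fourier_product_rV.
by rewrite !linear0.
Qed.

(** The zeros of the transform of a product need not form a group with 0. The induction therefore
    carries [spectral_factor], which is stable under products. *)
Lemma bigproduct_factor k (dims : 'I_k -> nat)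
    (mu : forall i, {finite_measure set (borel_rV R (dims i)) -> \bar R}) :
  (forall i, mu i [set: _] != 0%E) ->
  (forall i, zmod_closed (mem (fourier_zeros (mu i) `|` [set 0]))) ->
  spectral_factor (fourier_weight (bigproduct_rV mu)) /\
  0 < mass (bigproduct_rV mu).
Proof.
elim: k dims mu => [|k IH] dims mu mu0 muZ.
  have m1 : mass (bigproduct_rV mu) = 1.
    rewrite /mass (_ : bigproduct_rV mu [set: _] = 1%E)//.
    exact: (diracT R ((0 : 'rV[R]_0) : borel_rV R 0)).
  rewrite m1; split=> //.
  rewrite (_ : fourier_weight _ = fun=> 1); first exact: spectral_factor_cst1.
  by apply/funext => a; rewrite (thinmx0 a) fourier_weight0// m1.
have [IH1 IH2] := IH _ _ (fun i => mu0 (lift ord0 i)) (fun i => muZ (lift ord0 i)).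
have m0 := mass_gt0 (mu0 ord0).
split; last by rewrite /= mass_product_rV mulr_gt0.
change (spectral_factor (fourier_weight
  (product_rV (mu ord0) (bigproduct_rV (fun i => mu (lift ord0 i)))))).
rewrite (_ : fourier_weight _ = fun a => fourier_weight (mu ord0) (lsubmx a) *
    fourier_weight (bigproduct_rV (fun i => mu (lift ord0 i))) (rsubmx a)).
  by apply: spectral_factorM IH1; exact: fourier_weight_factor.
apply/funext => a; rewrite /fourier_weight fourier_product_rV mass_product_rV.
by rewrite sqnormcM exprMn invfM mulrACA.
Qed.

End characters.

Theorem corollary1p3 (R : realType) (k : nat) (hk : (1 <= k)%N)
    (dims : 'I_k -> nat)
    (mu : forall i, {finite_measure set (borel_rV R (dims i)) -> \bar R})
    (d : nat) (nu : {finite_measure set (borel_rV R d) -> \bar R})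
    (mu_neq0 : forall i, mu i [set: _] != 0%E)
    (nu_neq0 : nu [set: _] != 0%E)
    (hZ : forall i, zmod_closed (mem (fourier_zeros (mu i) `|` [set 0]))) :
  spectral_measure (product_rV (bigproduct_rV mu) nu) -> spectral_measure nu.
Proof.
move=> [L [cL bL]].
have [[_ _ qP] mu0] := bigproduct_factor mu_neq0 hZ.
have nu0 := mass_gt0 nu_neq0.
set m := bigproduct_rV mu in bL qP mu0 *.
have rho0 : 0 < mass (product_rV m nu) by rewrite mass_product_rV mulr_gt0.
pose E (a b : 'rV[R]_d) := cL2dot nu (expchar a) (expchar b) = 0.
have Eirr a : ~ E a a.
  move=> /eqP; rewrite cL2dot_self sqnorm_expchar eq_complex/= eqxx andbT.
  by rewrite gt_eqF.
pose phi (l : 'rV[R]_(dimsum dims + d)) := (lsubmx l, rsubmx l).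
have phiI : set_inj L phi.
  by move=> a a' _ _ [al ar]; rewrite -(hsubmxK a) -(hsubmxK a') al ar.
have oL : pairwise_rel (prod_rel (fourier_weight m) E) (phi @` L).
  move=> _ _ [a La <-] [b Lb <-] ab.
  have [_ /(_ b a Lb La) + _] := bL.
  have ba : b != a by apply/eqP => ba; apply: ab; rewrite ba.
  move=> /(_ ba) /eqP; rewrite cL2dot_expchar fourier_product_rV mulf_eq0.
  rewrite !linearB => /orP[] /eqP h.
    by left; apply/fourier_weight_eq0.
  right; rewrite /E cL2dotC; [|exact: cL2_expchar..].
  by rewrite cL2dot_expchar h conjc0.
(* The index runs over all of $L^2(\nu)$, so that one [G] satisfies Parseval's identity for every
   [f]. *)
have [_ /(_ {f | cL2 nu f})] := qP _ _ Eirr _ oL.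
move=> /(_ (fun f b => sqnormc (cL2dot nu (sval f) (expchar b)))
  (fun f => mass nu * sqnorm nu (sval f))).
have bessel_nu (f : {f | cL2 nu f}) := bessel_cL2 (@cL2_expchar _ _ nu) nu0
  (@sqnorm_expchar _ _ nu) (proj2_sig f).
case=> // [[f hf] xi|G [GL oG GN]] /=.
  (* Parseval's identity for $e_\xi\otimes f$ in the given basis of the product, divided below by
     the squared mass of [m], is the required weighted identity. *)
  have [ch chE] := cL2_product_rV (@cL2_expchar _ _ m xi) hf.
  have := orthogonal_basis_esum (@cL2_expchar _ _ (product_rV m nu)) rho0
    (@sqnorm_expchar _ _ (product_rV m nu)) bL ch.
  rewrite chE sqnorm_expchar mass_product_rV => parseval.
  rewrite esum_image//=.
  have mu2 : 0 < (mass m ^+ 2)^-1 by rewrite invr_gt0 exprn_gt0.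
  have := congr1 (fun x => ((mass m ^+ 2)^-1)%:E * x)%E parseval.
  rewrite -esumZl//; last by move=> a; exact: sqnormc_ge0.
  rewrite -EFinM; set y := (X in _ = X%:E) => yE.
  rewrite (_ : mass nu * sqnorm nu f = y); last first.
    by rewrite /y; field; rewrite gt_eqF.
  rewrite -yE; apply: eq_esum => a _; rewrite cL2dot_product_rV// sqnormcM.
  by congr EFin; rewrite /fourier_weight mulrA [_^-1 * _]mulrC.
exists G; split.
  (* [G] consists of second components of points of [L]. *)
  apply: sub_countable cL.
  apply: card_le_trans (card_image_le (@rsubmx R 1 _ d) L).
  apply: subset_card_le.
  by move=> b /GL[_ [a La <-] <-]; exists a.
apply: (esum_orthogonal_basis (@cL2_expchar _ _ nu) nu0 (@sqnorm_expchar _ _ nu)) => //.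
by move=> f hf; exact: (GN (exist _ f hf)).
Qed.
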